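(* Let $k$ be an algebraically closed field of characteristic not $2$ or $3$, and let $\mathcal C$ be the binary cubic generic Clifford algebra over $k$. The point variety of $\mathcal C$ is given by the pair $(\mathbb P^1\times\mathbb P^1\times\mathbb P^1,\ \mathrm{id})$. That is, the sequences $(p_0,p_1,p_2,\dots)\in\mathbb P^1\times\mathbb P^1\times\cdots$ for which $M(p_0,p_1,p_2,\dots)$ is a point module over $\mathcal C$ are exactly those in the image of the embedding $\mathbb P^1\times\mathbb P^1\times\mathbb P^1\hookrightarrow \mathbb P^1\times\mathbb P^1\times\cdots$, $\underline p=(p_0,p_1,p_2)\mapsto(\underline p,\underline p,\underline p,\dots)$.
   Context: The binary cubic generic Clifford algebra $\mathcal C$ is the quotient of the free algebra $k\langle x,y\rangle$ by the relations $$x^3y-yx^3,\qquad x^2y^2+xyxy-yxyx-y^2x^2,\qquad xy^3-y^3x,$$ graded by $\deg x=\deg y=1$. A point module over $\mathcal C$ is a graded module $M=\bigoplus_{i\ge0}M_i$ generated by $M_0$ with $\dim_k M_i=1$ for all $i\ge 0$. Every point module can be written as $M(p_0,p_1,p_2,\dots)=\bigoplus_{i\ge0}k\,e_i$ with $e_i$ in degree $i$, where $0\ne p_i=(x_i,y_i)\in k^2$ and the action is $xe_i=x_ie_{i+1}$, $ye_i=y_ie_{i+1}$. Two point modules $M(p_0,p_1,\dots)$ and $M(q_0,q_1,\dots)$ are isomorphic as graded modules if and only if $p_i=q_i$ in $\mathbb P^1$ for all $i$. So isomorphism classes of point modules are parametrized by a subset of $\mathbb P^1\times\mathbb P^1\times\cdots$,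 called the point variety of $\mathcal C$. One says that the point variety is given by a pair $(X,\sigma)$, with $X$ a variety and $\sigma:X\to X$ an automorphism, if it is the image of the natural embedding $x\mapsto(x,\sigma(x),\sigma^2(x),\dots)$ of $X$ (here, for $X=\mathbb P^1\times\mathbb P^1\times\mathbb P^1$, the sequence is formed by concatenating the triples). *)

(* Defs.v *)
From HB Require Import structures.
From mathcomp Require Import all_boot all_order all_algebra.
From mathcomp Require Import finmap boolp classical_sets.
From mathcomp.multinomials Require Import monalg.

Set Implicit Arguments.
Unset Strict Implicit.
Unset Printing Implicit Defensive.

Import GRing.Theory.
Local Open Scope quotient_scope.
Local Open Scope classical_set_scope.
Local Open Scope ring_scope.

Definition two_sided_ideal (R : nzRingType) (J : set R) : Prop :=
  [/\ J 0, forall u v, J u -> J v -> J (u - v) &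
      forall a b u, J u -> J (a * u * b)].

Section FreeAlgebra.
Variable k : fieldType.

Lemma malg_scalerAr (K : monomType) (c : k) (u v : {malg k[K]}) :
  c *: (u * v) = u * (c *: v).
Proof.
rewrite malgME scaler_sumr.
rewrite [RHS](malgMEw (fsubset_refl _) (msuppZ_le c v)).
apply: eq_bigr => w _; rewrite scaler_sumr; apply: eq_bigr => w' _.
apply/malgP => w''; rewrite mcoeffZ [RHS]mcoeffU mcoeffZ.
by rewrite (mulrCA u@_w c) mcoeffU mulrnAr.
Qed.

(* k<x, y>: finitely supported functions on the free monoid of words in two
   letters. *)
Definition free_alg : Type := {malg k[{fmonom 'I_2}]}.

HB.instance Definition _ := GRing.Lalgebra.on free_alg.
HB.instance Definition _ :=
  GRing.Lalgebra_isAlgebra.Build k free_alg (@malg_scalerAr {fmonom 'I_2}).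

Definition free_x : free_alg := << fmu (0 : 'I_2) >>.
Definition free_y : free_alg := << fmu (1 : 'I_2) >>.

(* The degree n component, for deg x = deg y = 1. *)
Definition free_gr (n : nat) : set free_alg :=
  [set u | forall w, u@_w != 0 -> fdeg w = n].

Definition cliff_rel : set free_alg :=
  let x := free_x in let y := free_y in
  [set x ^+ 3 * y - y * x ^+ 3;
       x ^+ 2 * y ^+ 2 + x * y * x * y - y * x * y * x - y ^+ 2 * x ^+ 2;
       x * y ^+ 3 - y ^+ 3 * x].

Definition cliff_ideal : pred free_alg :=
  fun u => `[< smallest (@two_sided_ideal free_alg) cliff_rel u >].

Lemma cliff_idealP u :
  reflect (forall J, two_sided_ideal J -> cliff_rel `<=` J -> J u)
          (u \in cliff_ideal).
Proof.
by apply: (iffP (asboolP _)) => [h J Ji Jr|h J [Ji Jr]]; exact: h.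
Qed.

Lemma cliff_ideal_zmod_closed : zmod_closed cliff_ideal.
Proof.
split=> [|u v /cliff_idealP hu /cliff_idealP hv].
  by apply/cliff_idealP => J [].
apply/cliff_idealP => J Ji Jr; case: (Ji) => _ JB _.
by apply: JB; [exact: hu|exact: hv].
Qed.

HB.instance Definition _ :=
  GRing.isZmodClosed.Build free_alg cliff_ideal cliff_ideal_zmod_closed.

Lemma cliff_idealD u v :
  u \in cliff_ideal -> v \in cliff_ideal -> u + v \in cliff_ideal.
Proof. exact: rpredD. Qed.

Lemma cliff_idealM a b u : u \in cliff_ideal -> a * u * b \in cliff_ideal.
Proof.
move=> /cliff_idealP hu; apply/cliff_idealP => J Ji Jr; case: (Ji) => _ _ JM.
by apply: JM; exact: hu.
Qed.

Lemma cliff_idealMl a u : u \in cliff_ideal -> a * u \in cliff_ideal.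
Proof. by move=> /(cliff_idealM a 1); rewrite mulr1. Qed.

Lemma cliff_idealMr b u : u \in cliff_ideal -> u * b \in cliff_ideal.
Proof. by move=> /(cliff_idealM 1 b); rewrite mul1r. Qed.

Lemma cliff_ideal_rel u : cliff_rel u -> u \in cliff_ideal.
Proof. by move=> ru; apply/cliff_idealP => J _; exact. Qed.

Lemma cliff_ideal1 : 1 \notin cliff_ideal.
Proof.
pose J : set free_alg := [set u | mcoeff (mone : {fmonom 'I_2}) u = 0].
have JX i : J << fmu i >>.
  rewrite /J /= mcoeffU1; case: eqP => // /(congr1 (@fdeg _)).
  by rewrite fdegU fdeg1.
have Jx : J free_x by exact: JX.
have Jy : J free_y by exact: JX.
have J_ideal : two_sided_ideal J.
  split=> /= [|u v hu hv|a b u hu]; rewrite /J /=; first exact: mcoeff0.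
    by rewrite mcoeffB hu hv subrr.
  by rewrite !rmorphM /= hu mulr0 mul0r.
have J_rel : cliff_rel `<=` J.
  have JM a u : J u -> J (a * u) by rewrite /J /= rmorphM /= => ->; rewrite mulr0.
  have JB u v : J u -> J v -> J (u - v) by case: J_ideal => _ + _; apply.
  have JD u v : J u -> J v -> J (u + v).
    by rewrite /J /= mcoeffD => -> ->; rewrite addr0.
  have JXn u n : J u -> J (u ^+ n.+1) by rewrite exprSr; exact: JM.
  move=> u [[->|->]|->]; first by apply: JB; apply: JM => //; exact: JXn.
    apply: (JB _ (_ ^+ 2 * _)); last by apply: JM; apply: JXn.
    apply: (JB _ (_ * _ * _ * _)); last by apply: JM.
    by apply: JD; apply: JM => //; exact: JXn.
  by apply: JB; apply: JM => //; exact: JXn.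
apply/negP => /cliff_idealP /(_ J J_ideal J_rel).
by rewrite /J /= mcoeff1 eqxx => /eqP; rewrite oner_eq0.
Qed.

End FreeAlgebra.

Section CliffordAlgebra.
Variable k : fieldType.
Local Notation F := (free_alg k).
Local Notation I := (@cliff_ideal k).

Definition clifford : Type :=
  Quotient.quot (GRing.ZmodClosed.clone F I _).

HB.instance Definition _ := GRing.Zmodule.on clifford.
HB.instance Definition _ := ZmodQuotient.on clifford.

Implicit Types (u v w : F) (p q r : clifford).

Lemma clifford_eqP u v :
  reflect (\pi_clifford u = \pi_clifford v) (u - v \in I).
Proof. by rewrite Quotient.idealrBE; exact: eqP. Qed.

Lemma clifford_reprB u : u - repr (\pi_clifford u) \in I.
Proof. by apply/clifford_eqP; rewrite reprK. Qed.

Definition cliff_one : clifford := \pi_clifford 1.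
Definition cliff_mul p q : clifford := \pi_clifford (repr p * repr q).
Definition cliff_scale (c : k) p : clifford := \pi_clifford (c *: repr p).

Lemma cliff_pi_mul u v :
  cliff_mul (\pi_clifford u) (\pi_clifford v) = \pi_clifford (u * v).
Proof.
apply/esym/clifford_eqP; set u' := repr _; set v' := repr _.
have -> : u * v - u' * v' = (u - u') * v + u' * (v - v').
  by rewrite mulrBl mulrBr addrA subrK.
apply: cliff_idealD; first exact: (cliff_idealMr v (clifford_reprB u)).
exact: (cliff_idealMl u' (clifford_reprB v)).
Qed.

Lemma cliff_pi_scale c u : cliff_scale c (\pi_clifford u) = \pi_clifford (c *: u).
Proof.
apply/esym/clifford_eqP; rewrite -scalerBr -mulr_algl.
exact: (cliff_idealMl _ (clifford_reprB u)).
Qed.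

Lemma cliff_ind (P : clifford -> Prop) :
  (forall u, P (\pi_clifford u)) -> forall p, P p.
Proof. by move=> Pu p; rewrite -[p]reprK. Qed.

Lemma cliff_piD u v : \pi_clifford u + \pi_clifford v = \pi_clifford (u + v).
Proof. by rewrite !piE. Qed.

Lemma cliff_mulA : associative cliff_mul.
Proof.
elim/cliff_ind=> u; elim/cliff_ind=> v; elim/cliff_ind=> w.
by rewrite !cliff_pi_mul mulrA.
Qed.

Lemma cliff_mul1 : left_id cliff_one cliff_mul.
Proof. by elim/cliff_ind=> u; rewrite cliff_pi_mul mul1r. Qed.

Lemma cliff_1mul : right_id cliff_one cliff_mul.
Proof. by elim/cliff_ind=> u; rewrite cliff_pi_mul mulr1. Qed.

Lemma cliff_mulDl : left_distributive cliff_mul +%R.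
Proof.
elim/cliff_ind=> u; elim/cliff_ind=> v; elim/cliff_ind=> w.
by rewrite !(cliff_piD, cliff_pi_mul) mulrDl.
Qed.

Lemma cliff_mulDr : right_distributive cliff_mul +%R.
Proof.
elim/cliff_ind=> u; elim/cliff_ind=> v; elim/cliff_ind=> w.
by rewrite !(cliff_piD, cliff_pi_mul) mulrDr.
Qed.

Lemma cliff_1neq0 : cliff_one != 0.
Proof.
have -> : (0 : clifford) = \pi_clifford 0 by rewrite !piE.
apply/eqP => /clifford_eqP; rewrite subr0.
by apply/negP; exact: cliff_ideal1.
Qed.

HB.instance Definition _ := GRing.Zmodule_isNzRing.Build clifford
  cliff_mulA cliff_mul1 cliff_1mul cliff_mulDl cliff_mulDr cliff_1neq0.

Lemma cliff_piM u v : \pi_clifford u * \pi_clifford v = \pi_clifford (u * v).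
Proof. exact: cliff_pi_mul. Qed.

Lemma cliff_scaleA a b p :
  cliff_scale a (cliff_scale b p) = cliff_scale (a * b) p.
Proof. by elim/cliff_ind: p => u; rewrite !cliff_pi_scale scalerA. Qed.

Lemma cliff_scale1 : left_id 1 cliff_scale.
Proof. by elim/cliff_ind=> u; rewrite cliff_pi_scale scale1r. Qed.

Lemma cliff_scaleDr : right_distributive cliff_scale +%R.
Proof.
move=> c; elim/cliff_ind=> u; elim/cliff_ind=> v.
by rewrite !(cliff_piD, cliff_pi_scale) scalerDr.
Qed.

Lemma cliff_scaleDl p : {morph cliff_scale^~ p : a b / a + b}.
Proof.
move=> a b; elim/cliff_ind: p => u.
by rewrite !cliff_pi_scale cliff_piD scalerDl.
Qed.

HB.instance Definition _ := GRing.Zmodule_isLmodule.Build k clifford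
  cliff_scaleA cliff_scale1 cliff_scaleDr cliff_scaleDl.

Lemma cliff_piZ c u : c *: \pi_clifford u = \pi_clifford (c *: u).
Proof. exact: cliff_pi_scale. Qed.

Lemma cliff_scaleAl (c : k) p q : c *: (p * q) = (c *: p) * q.
Proof.
elim/cliff_ind: p => u; elim/cliff_ind: q => v.
by rewrite cliff_piM !cliff_piZ cliff_piM scalerAl.
Qed.

HB.instance Definition _ :=
  GRing.Lmodule_isLalgebra.Build k clifford cliff_scaleAl.

Lemma cliff_scaleAr (c : k) p q : c *: (p * q) = p * (c *: q).
Proof.
elim/cliff_ind: p => u; elim/cliff_ind: q => v.
by rewrite cliff_piM !cliff_piZ cliff_piM scalerAr.
Qed.

HB.instance Definition _ :=
  GRing.Lalgebra_isAlgebra.Build k clifford cliff_scaleAr.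

Definition cliff_x : clifford := \pi_clifford (free_x k).
Definition cliff_y : clifford := \pi_clifford (free_y k).

Definition cliff_gr (n : nat) : set clifford :=
  [set \pi_clifford u | u in @free_gr k n].

End CliffordAlgebra.

(* The scalars c : k act on a left A-module through c%:A. *)
Section GradedModules.
Variables (k : fieldType) (A : algType k) (grA : nat -> set A).

Definition submodule (M : lmodType A) (N : set M) : Prop :=
  [/\ N 0, forall m m', N m -> N m' -> N (m + m') &
      forall (a : A) m, N m -> N (a *: m)].

Definition subspace (M : lmodType A) (V : set M) : Prop :=
  [/\ V 0, forall m m', V m -> V m' -> V (m + m') &
      forall (c : k) m, V m -> V (c%:A *: m)].

Definition line (M : lmodType A) (e : M) : set M :=
  [set c%:A *: e | c in [set: k]].

Record graded_module (M : lmodType A) (grM : nat -> set M) : Prop :=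
  GradedModule {
    graded_subspace : forall i, subspace (grM i);
    graded_sum : forall m : M, exists (n : nat) (u : nat -> M),
      (forall i, grM i (u i)) /\ m = \sum_(i < n) u i;
    graded_direct : forall (n : nat) (u : nat -> M),
      (forall i, grM i (u i)) -> \sum_(i < n) u i = 0 ->
      forall i, (i < n)%N -> u i = 0;
    graded_action : forall i j a m,
      grA i a -> grM j m -> grM (i + j)%N (a *: m)
  }.

Record point_module (M : lmodType A) (grM : nat -> set M) : Prop :=
  PointModule {
    point_graded : graded_module grM;
    point_generated : smallest (@submodule M) (grM 0%N) = [set: M];
    point_dim1 : forall i, exists2 e : M, e != 0 & grM i = line e
  }.

End GradedModules.

(* Points are the lines through the origin of k^2, so that equality of points
   is Leibniz equality. *)
Definition P1 (k : fieldType) : Type :=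
  {U : {vspace 'rV[k]_2} | (\dim U == 1)%N}.

Section PointVariety.
Variable k : fieldType.
Local Notation C := (clifford k).

(* M, graded by grM, is M(v_0, v_1, v_2, ...): M_i = k e_i, with
   x e_i = x_i e_(i+1) and y e_i = y_i e_(i+1) for v_i = (x_i, y_i). *)
Definition is_M_of (v : nat -> 'rV[k]_2) (M : lmodType C) (grM : nat -> set M) :
    Prop :=
  exists e : nat -> M, forall i,
    [/\ e i != 0, grM i = line (e i),
        cliff_x k *: e i = (v i 0 0)%:A *: e i.+1 &
        cliff_y k *: e i = (v i 0 1)%:A *: e i.+1].

Definition M_is_point_module (v : nat -> 'rV[k]_2) : Prop :=
  exists (M : lmodType C) (grM : nat -> set M),
    point_module (@cliff_gr k) grM /\ is_M_of v grM.

(* The v i are nonzero, since the lines val (P i) have dimension 1. *)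
Definition represents (v : nat -> 'rV[k]_2) (P : nat -> P1 k) : Prop :=
  forall i, val (P i) = <[v i]>%VS.

Definition point_variety : set (nat -> P1 k) :=
  [set P | exists2 v, represents v P & M_is_point_module v].

Definition P1cube : Type := (P1 k * P1 k * P1 k)%type.

Definition coord3 (q : P1cube) (j : nat) : P1 k :=
  match j with 0%N => q.1.1 | 1%N => q.1.2 | _ => q.2 end.

(* The embedding of P1cube that sends q to the concatenation of the triples
   q, sigma q, sigma (sigma q), ... *)
Definition orbit_seq (sigma : P1cube -> P1cube) (q : P1cube) : nat -> P1 k :=
  fun n => coord3 (iter (n %/ 3)%N sigma q) (n %% 3)%N.

Definition given_by_pair (V : set (nat -> P1 k)) (sigma : P1cube -> P1cube) :
    Prop :=
  injective (orbit_seq sigma) /\ V = range (orbit_seq sigma).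

End PointVariety.

Arguments point_variety : clear implicits.

(* Main.v *)
(* Applying the three relations to e_i gives D L = 0, where
   D = y_i x_(i+3) - x_i y_(i+3) and L runs over the coefficients x_(i+1) x_(i+2),
   y_(i+1) x_(i+2) + x_(i+1) y_(i+2) and y_(i+1) y_(i+2) of a product of two
   nonzero linear forms.  Hence D = 0, i.e. p_(i+3) = p_i.  Conversely, for a
   3-periodic choice of the (x_i, y_i) the same computation shows that the action
   of the free algebra on k[X], with e_i = X^i, factors through the Clifford
   algebra. *)
Require Import Defs.
From HB Require Import structures.
From mathcomp Require Import all_boot all_order all_algebra ring.
From mathcomp Require Import finmap boolp classical_sets.
From mathcomp.multinomials Require Import monalg.

Set Implicit Arguments.
Unset Strict Implicit.
Unset Printing Implicit Defensive.

Import GRing.Theory.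
Local Open Scope quotient_scope.
Local Open Scope ring_scope.

Lemma ord2_cases (P : 'I_2 -> Prop) : P 0 -> P 1 -> forall j, P j.
Proof.
move=> P0 P1 [[|[|//]] j_lt].
  by have -> : Ordinal j_lt = 0 by exact: val_inj.
by have -> : Ordinal j_lt = 1 by exact: val_inj.
Qed.

(** * Lines in the plane and products of linear forms *)

Section Points.
Variable k : fieldType.

Lemma row2_coord_neq0 (w : 'rV[k]_2) : w != 0 -> (w 0 0 != 0) || (w 0 1 != 0).
Proof.
apply: contraNT; rewrite negb_or !negbK => /andP[/eqP w0 /eqP w1].
by apply/eqP/rowP; apply: ord2_cases; rewrite mxE.
Qed.

(** A nonzero [D] would force every coefficient of (a_0 s + a_1 t)(b_0 s + b_1 t) to vanish, which
    is impossible in the domain k[s,t]. Here this becomes a case split on the vanishing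
    coordinates. *)
Lemma form_product_annihilator (a b : 'rV[k]_2) (D : k) :
  a != 0 -> b != 0 -> D * (a 0 0 * b 0 0) = 0 ->
  D * (a 0 1 * b 0 0 + a 0 0 * b 0 1) = 0 -> D * (a 0 1 * b 0 1) = 0 ->
  D = 0.
Proof.
move=> /row2_coord_neq0 a_neq0 /row2_coord_neq0 b_neq0.
case: (eqVneq D 0) => // D_neq0.
move=> /eqP; rewrite mulf_eq0 (negPf D_neq0) mulf_eq0 /= => h0.
move=> /eqP; rewrite mulf_eq0 (negPf D_neq0) /= => h1.
move=> /eqP; rewrite mulf_eq0 (negPf D_neq0) mulf_eq0 /= => h2.
move: h0 h1 h2 a_neq0 b_neq0.
case: (eqVneq (a 0 0) 0) => [->|a0] /=; case: (eqVneq (a 0 1) 0) => [->|a1] //=;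
  case: (eqVneq (b 0 0) 0) => [->|b0] //=; case: (eqVneq (b 0 1) 0) => [->|b1] //=;
  rewrite ?(mulr0, mul0r, addr0, add0r) ?mulf_eq0 ?(negPf a0) ?(negPf a1)
    ?(negPf b0) ?(negPf b1) //.
Qed.

(** The equation is the vanishing of a 2x2 determinant. Both lines have dimension 1, so it suffices
    that [a] is a multiple of [b]; the ratio is read off at a nonzero coordinate of [b]. *)
Lemma vline_eq (a b : 'rV[k]_2) : a != 0 -> b != 0 ->
  a 0 1 * b 0 0 = a 0 0 * b 0 1 -> <[a]>%VS = <[b]>%VS.
Proof.
move=> a_neq0 b_neq0 det0; apply/eqP.
rewrite eqEdim !dim_vline a_neq0 b_neq0 leqnn andbT.
apply/vlineP; case/orP: (row2_coord_neq0 b_neq0) => bj.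
  exists (a 0 0 / b 0 0); apply/rowP; apply: ord2_cases; rewrite mxE ?divfK //.
  by rewrite mulrAC -det0 mulfK.
exists (a 0 1 / b 0 1); apply/rowP; apply: ord2_cases; rewrite mxE ?divfK //.
by rewrite mulrAC det0 mulfK.
Qed.

Lemma P1_vlineP (p : P1 k) : exists w, val p = <[w]>%VS.
Proof.
exists (vpick (val p)); apply/eqP; rewrite eq_sym eqEdim -memvE memv_pick /=.
have /eqP p1 := valP p.
by rewrite dim_vline p1 vpick0 -dimv_eq0 p1.
Qed.

Lemma represents_neq0 (v : nat -> 'rV[k]_2) (P : nat -> P1 k) (i : nat) :
  represents v P -> v i != 0.
Proof.
by move=> vP; have := valP (P i); rewrite vP dim_vline; case: (v i != 0).
Qed.

End Points.

(* Over a variable ring, since conversion between terms of [free_alg k] unfolds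
   its multiplication. *)
Lemma relations_morph (R S : nzRingType) (J : R -> Prop) (f : R -> S)
    (x y : R) :
  {morph f : a b / a + b} -> {morph f : a b / a * b} ->
  (forall a b, J (a - b) -> f a = f b) ->
  J (x ^+ 3 * y - y * x ^+ 3) ->
  J (x ^+ 2 * y ^+ 2 + x * y * x * y - y * x * y * x - y ^+ 2 * x ^+ 2) ->
  J (x * y ^+ 3 - y ^+ 3 * x) ->
  [/\ f x * f x * f x * f y = f y * f x * f x * f x,
      f x * f x * f y * f y + f x * f y * f x * f y =
        f y * f x * f y * f x + f y * f y * f x * f x &
      f x * f y * f y * f y = f y * f y * f y * f x].
Proof.
move=> fD fM fJ; rewrite !exprSr !expr0 !mul1r !mulrA.
move=> /fJ r1 r2 /fJ r3; move: r2; rewrite -addrA -opprD => /fJ r2.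
by rewrite -!fM -!fD; split.
Qed.

(** * Four-letter words acting on a chain of vectors *)

Section PointAction.
Variables (k : fieldType) (A : algType k) (M : lmodType A).
Implicit Types (m : M) (c d : k).

Lemma scale_algD c d m : (c + d)%:A *: m = c%:A *: m + d%:A *: m.
Proof. by rewrite !scalerDl. Qed.

Lemma scale_algA c d m : c%:A *: (d%:A *: m) = (c * d)%:A *: m.
Proof. by rewrite scalerA mulr_algl scalerA. Qed.

Lemma scale_alg_comm (a : A) c m : a *: (c%:A *: m) = c%:A *: (a *: m).
Proof. by rewrite !scalerA mulr_algl mulr_algr. Qed.

Lemma scale_alg_inj m c d : m != 0 -> c%:A *: m = d%:A *: m -> c = d.
Proof.
move=> m_neq0 cmdm; apply/eqP; rewrite -subr_eq0.
apply: contraNT m_neq0 => cd_neq0; have -> : m = 1%:A *: m by rewrite !scale1r.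
by rewrite -(mulVf cd_neq0) -scale_algA !scalerBl cmdm subrr scaler0.
Qed.

Variables (v : nat -> 'rV[k]_2) (e : nat -> M) (g : 'I_2 -> A).
Hypothesis e_neq0 : forall i, e i != 0.
Hypothesis gE : forall i j, g j *: e i = (v i 0 j)%:A *: e i.+1.

(** The rightmost letter acts first, so [d] is paired with [v i] and [a] with [v i.+3]. *)
Lemma word4_scale i (a b c d : 'I_2) : (g a * g b * g c * g d) *: e i =
  (v i 0 d * v i.+1 0 c * v i.+2 0 b * v i.+3 0 a)%:A *: e i.+4.
Proof.
have gZ j u m : g j *: (u%:A *: m) = u%:A *: (g j *: m) by exact: scale_alg_comm.
by rewrite -3![LHS]scalerA !(gE, gZ) !scale_algA.
Qed.

(** Both sides of each relation send [e i] to multiples of the nonzero vector [e i.+4], so their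
    coefficients agree. In each difference the outer letters contribute the common factor [D]. *)
Lemma word_relations i (x := fun n => v n 0 0) (y := fun n => v n 0 1)
    (D := y i * x i.+3 - x i * y i.+3) (X := g 0) (Y := g 1) :
  X * X * X * Y = Y * X * X * X ->
  X * X * Y * Y + X * Y * X * Y = Y * X * Y * X + Y * Y * X * X ->
  X * Y * Y * Y = Y * Y * Y * X ->
  [/\ D * (x i.+1 * x i.+2) = 0,
      D * (y i.+1 * x i.+2 + x i.+1 * y i.+2) = 0 &
      D * (y i.+1 * y i.+2) = 0].
Proof.
rewrite /X /Y => r1 r2 r3; have := congr1 (fun p => p *: e i) r1.
have := congr1 (fun p => p *: e i) r2.
have := congr1 (fun p => p *: e i) r3.
rewrite /= !scalerDl !word4_scale -!scale_algD.
move=> /(scale_alg_inj (e_neq0 _)) h3 /(scale_alg_inj (e_neq0 _)) h2.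
move=> /(scale_alg_inj (e_neq0 _)) h1.
rewrite /D /x /y; split; apply/eqP; rewrite mulrBl subr_eq0; apply/eqP.
- by apply: etrans (etrans _ h1) _; ring.
- by apply: etrans (etrans _ h2) _; ring.
- by apply: etrans (etrans _ h3) _; ring.
Qed.

End PointAction.

(** * The relations force period three *)

Section Relations.
Variable k : fieldType.
Local Notation X := (cliff_x k).
Local Notation Y := (cliff_y k).

Lemma cliff_relations :
  [/\ X * X * X * Y = Y * X * X * X,
      X * X * Y * Y + X * Y * X * Y = Y * X * Y * X + Y * Y * X * X &
      X * Y * Y * Y = Y * Y * Y * X].
Proof.
apply: (@relations_morph (free_alg k) (clifford k)
  (fun u => u \in @cliff_ideal k) (fun u => \pi_(clifford k) u)
  (free_x k) (free_y k)).
- by move=> u v; rewrite cliff_piD.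
- by move=> u v; rewrite cliff_piM.
- by move=> u v /clifford_eqP.
- by apply: cliff_ideal_rel; left; left.
- by apply: cliff_ideal_rel; left; right.
- by apply: cliff_ideal_rel; right.
Qed.

(** The factor [D] of [word_relations] is, up to sign, the determinant of [v i] and [v i.+3]; once
    it vanishes, the two vectors span the same line. *)
Lemma is_M_of_periodic (v : nat -> 'rV[k]_2) (M : lmodType (clifford k))
    (grM : nat -> set M) (P : nat -> P1 k) :
  represents v P -> is_M_of v grM -> forall i, P i.+3 = P i.
Proof.
move=> vP [e eP] i; apply: val_inj; rewrite !vP.
have v_neq0 j := represents_neq0 j vP.
pose g (j : 'I_2) : clifford k := if j == 0 then X else Y.
have gE n j : g j *: e n = (v n 0 j)%:A *: e n.+1.
  case: (eP n) => _ _ xe ye.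
  by move: j; apply: ord2_cases; [exact: xe|exact: ye].
have e_neq0 n : e n != 0 by case: (eP n).
have [r1 r2 r3] := cliff_relations.
have [h1 h2 h3] := word_relations e_neq0 gE i r1 r2 r3.
apply: (vline_eq (v_neq0 _) (v_neq0 _)).
have D0 := form_product_annihilator (v_neq0 i.+1) (v_neq0 i.+2) h1 h2 h3.
by rewrite mulrC [RHS]mulrC; apply/esym/eqP; rewrite -subr_eq0 D0.
Qed.

End Relations.

(** Stated over a variable ring for the same reason as [relations_morph]; it turns the relators into
    compositions of the letter operators. *)
Lemma relations_act (R : nzRingType) (V : zmodType) (f : R -> V -> V)
    (x y : R) (X Y : V -> V) (m : V) :
  (forall a b m, f (a + b) m = f a m + f b m) ->
  (forall a b m, f (a - b) m = f a m - f b m) ->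
  (forall a b m, f (a * b) m = f a (f b m)) ->
  f x =1 X -> f y =1 Y ->
  [/\ f (x ^+ 3 * y - y * x ^+ 3) m = X (X (X (Y m))) - Y (X (X (X m))),
      f (x ^+ 2 * y ^+ 2 + x * y * x * y - y * x * y * x - y ^+ 2 * x ^+ 2) m =
        X (X (Y (Y m))) + X (Y (X (Y m)))
        - Y (X (Y (X m))) - Y (Y (X (X m))) &
      f (x * y ^+ 3 - y ^+ 3 * x) m = X (Y (Y (Y m))) - Y (Y (Y (X m)))].
Proof.
move=> fD fB fM fx fy; rewrite !exprSr !expr0 !mul1r !(fB, fD) !fM.
by rewrite !(fx, fy).
Qed.

(** * The free algebra acting on polynomials *)

Section FreeAction.
Variables (k : fieldType) (v : nat -> 'rV[k]_2).
Implicit Types (m : {poly k}) (u t : free_alg k) (w : {fmonom 'I_2}).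

(* The vector e_n of M(v_0, v_1, ...) is 'X^n. *)
Definition letter_act (j : 'I_2) m : {poly k} :=
  'X * \poly_(n < size m) (v n 0 j * m`_n).

Lemma coef_letter_act j m n :
  (letter_act j m)`_n = if n is n'.+1 then v n' 0 j * m`_n' else 0.
Proof.
case: n => [|n]; rewrite coefXM //= coef_poly; case: ltnP => // n_ge.
by rewrite nth_default ?mulr0.
Qed.

Lemma letter_act_is_linear j : linear (letter_act j).
Proof.
move=> c m m'; apply/polyP => -[|n].
  by rewrite coefD coefZ !coef_letter_act mulr0 addr0.
by rewrite !(coefD, coefZ, coef_letter_act) mulrDr mulrCA.
Qed.

HB.instance Definition _ j :=
  GRing.isLinear.Build k {poly k} {poly k} *:%R (letter_act j)
    (letter_act_is_linear j).

Lemma letter_actXn j n : letter_act j 'X^n = v n 0 j *: 'X^(n.+1).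
Proof.
apply/polyP => -[|i]; rewrite coef_letter_act coefZ !coefXn ?mulr0 // eqSS.
by case: eqP => [->|_]; rewrite ?mulr0.
Qed.

(** With [foldr] the last letter acts first, as in a left module. *)
Definition word_act (s : seq 'I_2) m : {poly k} := foldr letter_act m s.

Lemma word_act_is_linear s : linear (word_act s).
Proof. by move=> c m m'; elim: s => //= j s ->; rewrite linearP. Qed.

HB.instance Definition _ s :=
  GRing.isLinear.Build k {poly k} {poly k} *:%R (word_act s)
    (word_act_is_linear s).

Lemma word_actXn s n : exists c, word_act s 'X^n = c *: 'X^(size s + n).
Proof.
elim: s => [|j s [c /= ->]]; first by exists 1; rewrite scale1r.
by exists (c * v (size s + n) 0 j); rewrite linearZ /= letter_actXn scalerA.
Qed.

(** The linear extension of [word_act]. Since [mmap] takes values in a ring, coefficients act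
    through multiplication by constant polynomials. *)
Definition free_act u m : {poly k} := mmap (@polyC k) (fun w => word_act w m) u.

Lemma free_actE u m :
  free_act u m = \sum_(w <- msupp u) mcoeff w u *: word_act w m.
Proof. by rewrite /free_act mmapE; apply: eq_bigr => w _; rewrite mul_polyC. Qed.

Lemma free_actDl u t m : free_act (u + t) m = free_act u m + free_act t m.
Proof. exact: mmapD. Qed.

Lemma free_actBl u t m : free_act (u - t) m = free_act u m - free_act t m.
Proof. exact: mmapB. Qed.

Lemma free_act0l m : free_act 0 m = 0.
Proof. exact: mmap0. Qed.

Lemma free_act_word c w m : free_act (mkmalgU w c) m = c *: word_act w m.
Proof. by rewrite /free_act mmapU mul_polyC. Qed.

Lemma free_act_letter j m : free_act (mkmalgU (fmu j) 1) m = letter_act j m.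
Proof. by rewrite free_act_word scale1r fmU. Qed.

Lemma free_act1 m : free_act 1 m = m.
Proof. by rewrite [LHS]free_act_word scale1r fm1. Qed.

Lemma free_act_is_linear u : linear (free_act u).
Proof.
move=> c m m'; rewrite !free_actE scaler_sumr -big_split /=.
apply: eq_bigr => w _; rewrite linearP scalerDr !scalerA.
by rewrite [_ * c]mulrC.
Qed.

HB.instance Definition _ u :=
  GRing.isLinear.Build k {poly k} {poly k} *:%R (free_act u)
    (free_act_is_linear u).

(** On words this is [foldr_cat], concatenation acting as composition; the general case expands both
    factors bilinearly. *)
Lemma free_actM u t m : free_act (u * t) m = free_act u (free_act t m).
Proof.
rewrite malgME {1}/free_act raddf_sum [RHS]free_actE.
apply: eq_bigr => w _; rewrite raddf_sum [free_act t m]free_actE.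
rewrite raddf_sum scaler_sumr; apply: eq_bigr => w' _.
rewrite /= mmapU linearZ scalerA mul_polyC fmM.
by rewrite /word_act foldr_cat.
Qed.

Lemma free_actZ c u m : free_act (c *: u) m = c *: free_act u m.
Proof.
(* Scaling by [c] may shrink the support, so both sums are taken over the support of [u]. *)
rewrite [in RHS]free_actE /free_act (mmapEw (msuppZ_le c u)) scaler_sumr.
by apply: eq_bigr => w _; rewrite mul_polyC mcoeffZ scalerA.
Qed.

Lemma free_act_eq0 u :
  (forall n, free_act u 'X^n = 0) -> forall m, free_act u m = 0.
Proof.
move=> u0 m; rewrite -[m]coefK poly_def linear_sum big1 // => i _.
by rewrite linearZ /= u0 scaler0.
Qed.

Lemma letter_act4 a b c d n :
  letter_act a (letter_act b (letter_act c (letter_act d 'X^n))) =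
  (v n 0 d * v n.+1 0 c * v n.+2 0 b * v n.+3 0 a) *: 'X^(n.+4).
Proof.
have letter_actZ j (u : k) m : letter_act j (u *: m) = u *: letter_act j m.
  exact: linearZ.
by rewrite !(letter_actXn, letter_actZ) !scalerA.
Qed.

Hypothesis v_period : forall n, v n.+3 = v n.

(** By linearity it suffices to act on monomials. With period three the outer letters of each word
    are both evaluated at [v n], and the factor [D] becomes y_n x_n - x_n y_n = 0. *)
Lemma free_act_rel u m : cliff_rel u -> free_act u m = 0.
Proof.
move=> u_rel; move: m; apply: free_act_eq0 => n.
have [] := relations_act 'X^n free_actDl free_actBl free_actM
  (free_act_letter 0) (free_act_letter 1).
rewrite -/(free_x k) -/(free_y k) !letter_act4 !v_period.
case: u_rel => [[|]|] -> e1 e2 e3.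
- by apply: etrans e1 _; rewrite -scalerBl -[RHS](scale0r ('X^(n.+4) : {poly k}));
    congr (_ *: _); ring.
- by apply: etrans e2 _; rewrite -scalerDl -!scalerBl
    -[RHS](scale0r ('X^(n.+4) : {poly k}));
    congr (_ *: _); ring.
- by apply: etrans e3 _; rewrite -scalerBl -[RHS](scale0r ('X^(n.+4) : {poly k}));
    congr (_ *: _); ring.
Qed.

(** The annihilator of the action is a two-sided ideal containing the relators, hence contains the
    smallest such ideal. *)
Lemma free_act_ideal u m : u \in @cliff_ideal k -> free_act u m = 0.
Proof.
move=> /cliff_idealP uI; move: m.
apply: (uI [set t | forall m, free_act t m = 0]%classic) => [|t t_rel m].
  split=> [m|t t' t0 t'0 m|a b t t0 m]; first exact: free_act0l.
    by rewrite free_actBl t0 t'0 subr0.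
  by rewrite !free_actM t0 linear0.
exact: free_act_rel.
Qed.

End FreeAction.

(** The argument records [v] and its periodicity, so that a module structure over [clifford k],
    whose laws rely on both, can be attached to the type as an instance. *)
Definition orbit_module (k : fieldType) (v : nat -> 'rV[k]_2)
  of (forall n, v n.+3 = v n) : Type := {poly k}.

(** * The point module of a periodic sequence *)

Section OrbitModule.
Variables (k : fieldType) (v : nat -> 'rV[k]_2).
Hypothesis v_period : forall n, v n.+3 = v n.
Local Notation M := (orbit_module v_period).
Local Notation C := (clifford k).

HB.instance Definition _ := GRing.Zmodule.copy M {poly k}.

Definition orbit_act (p : C) (m : M) : M := free_act v (repr p) m.

(** Independence of the representative: two of them differ by an element of the ideal, which acts as
    zero. *)
Lemma orbit_act_pi u m : orbit_act (\pi_(C) u) m = free_act v u m.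
Proof.
apply/esym/eqP; rewrite -subr_eq0 -[X in X == _]free_actBl.
by rewrite free_act_ideal // clifford_reprB.
Qed.

Lemma orbit_actA p q m : orbit_act p (orbit_act q m) = orbit_act (p * q) m.
Proof.
elim/cliff_ind: p => u; elim/cliff_ind: q => t.
by rewrite cliff_piM !orbit_act_pi free_actM.
Qed.

Lemma orbit_act1 : left_id 1 orbit_act.
Proof. by move=> m; rewrite [LHS]orbit_act_pi free_act1. Qed.

Lemma orbit_actDr : right_distributive orbit_act +%R.
Proof. by move=> p m m'; exact: raddfD. Qed.

Lemma orbit_actDl m : {morph orbit_act^~ m : p q / p + q}.
Proof.
move=> p q; elim/cliff_ind: p => u; elim/cliff_ind: q => t.
by rewrite cliff_piD !orbit_act_pi free_actDl.
Qed.

HB.instance Definition _ := GRing.Zmodule_isLmodule.Build C M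
  orbit_actA orbit_act1 orbit_actDr orbit_actDl.

Lemma orbit_scale_pi (u : free_alg k) (m : M) :
  \pi_(C) u *: m = free_act v u m.
Proof. exact: orbit_act_pi. Qed.

Lemma orbit_scale_alg (c : k) (m : M) : (c%:A : C) *: m = c *: (m : {poly k}).
Proof.
have -> : (c%:A : C) = \pi_(C) (c *: 1) by exact: cliff_piZ.
by rewrite orbit_scale_pi free_actZ free_act1.
Qed.

Definition orbit_basis (n : nat) : M := 'X^n : {poly k}.

Lemma orbit_letter j n : \pi_(C) (mkmalgU (fmu j) 1) *: orbit_basis n =
  (v n 0 j)%:A *: orbit_basis n.+1.
Proof.
by rewrite orbit_scale_pi orbit_scale_alg free_act_letter letter_actXn.
Qed.

Definition orbit_gr (n : nat) : set M := line (orbit_basis n).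

Lemma orbit_grP n (m : M) :
  orbit_gr n m <-> exists c : k, m = c *: ('X^n : {poly k}).
Proof.
split=> [[c _ <-]|[c ->]]; exists c => //; first exact: orbit_scale_alg.
exact: orbit_scale_alg.
Qed.

Lemma orbit_gr_subspace n : subspace (orbit_gr n).
Proof.
split=> [|m m' /orbit_grP[c ->] /orbit_grP[c' ->]|c m /orbit_grP[c' ->]];
  apply/orbit_grP.
- by exists 0; rewrite scale0r.
- by exists (c + c'); rewrite scalerDl.
- by exists (c * c'); rewrite orbit_scale_alg scalerA.
Qed.

Lemma orbit_sum (m : M) :
  m = \sum_(i < size (m : {poly k})) ((m : {poly k})`_i)%:A *: orbit_basis i.
Proof.
rewrite -[LHS](@coefK k) poly_def; apply: eq_bigr => i _.
by rewrite orbit_scale_alg.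
Qed.

Lemma orbit_gr_direct (n : nat) (u : nat -> M) :
  (forall i, orbit_gr i (u i)) -> \sum_(i < n) u i = 0 ->
  forall i, (i < n)%N -> u i = 0.
Proof.
move=> u_gr u0 i i_lt; have /orbit_grP[c ui] := u_gr i.
have : (\sum_(j < n) (u j : {poly k}))`_i = 0.
  by rewrite [X in polyseq X]u0 coef0.
rewrite coef_sum (bigD1 (Ordinal i_lt)) //= big1 => [|j j_neq_i].
  by rewrite ui coefZ coefXn eqxx mulr1 addr0 => ->; rewrite scale0r.
have /orbit_grP[d ->] := u_gr j; rewrite coefZ coefXn.
by rewrite eq_sym (negPf (j_neq_i : j != i :> nat)) mulr0.
Qed.

(** A homogeneous [p] lifts to a combination of words of length [i], and each of these sends ['X^j]
    to a multiple of ['X^(i + j)]. *)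
Lemma orbit_gr_action i j (p : C) (m : M) :
  cliff_gr i p -> orbit_gr j m -> orbit_gr (i + j) (p *: m).
Proof.
move=> [u u_gr <-] /orbit_grP[c ->].
have [gr0 grD grZ] := orbit_gr_subspace (i + j).
rewrite orbit_scale_pi linearZ /= -orbit_scale_alg; apply: grZ.
rewrite free_actE big_seq; apply: (big_ind (orbit_gr (i + j))) => // w w_supp.
have <- : size w = i by apply: u_gr; rewrite mcoeff_neq0.
by have [d ->] := word_actXn v w j; apply/orbit_grP; eexists; rewrite scalerA.
Qed.

Lemma orbit_graded : graded_module (@cliff_gr k) orbit_gr.
Proof.
split; [exact: orbit_gr_subspace| |exact: orbit_gr_direct|exact: orbit_gr_action].
move=> m; exists (size (m : {poly k})).
exists (fun i => ((m : {poly k})`_i)%:A *: orbit_basis i).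
by split=> [i|]; [exists (m : {poly k})`_i|exact: orbit_sum].
Qed.

Hypothesis v_neq0 : forall n, v n != 0.

(** Some coordinate of [v n] is nonzero, and the corresponding letter carries ['X^n] to a nonzero
    multiple of ['X^(n.+1)]; so every monomial is reached from degree 0. *)
Lemma orbit_generated :
  smallest (@submodule k C M) (orbit_gr 0) = [set: M]%classic.
Proof.
apply/seteqP; split=> // m _ N [[N0 ND NZ] N_gr0].
have N_basis n : N (orbit_basis n).
  elim: n => [|n IHn].
    by apply: N_gr0; apply/orbit_grP; exists 1; rewrite scale1r.
  have [j vj] : exists j, v n 0 j != 0.
    by case/orP: (row2_coord_neq0 (v_neq0 n)) => vj; eexists; exact: vj.
  have -> : orbit_basis n.+1 =
      ((v n 0 j)^-1%:A : C) *: (\pi_(C) (mkmalgU (fmu j) 1) *: orbit_basis n).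
    by rewrite orbit_letter scale_algA mulVf // !scale1r.
  exact: (NZ _ _ (NZ _ _ IHn)).
by rewrite (orbit_sum m); apply: (big_ind N) => // i _; exact: NZ.
Qed.

Lemma orbit_basis_neq0 n : orbit_basis n != 0.
Proof. exact: monic_neq0 (monicXn k n). Qed.

Lemma orbit_is_point_module : M_is_point_module v.
Proof.
exists M, orbit_gr; split.
  split; [exact: orbit_graded|exact: orbit_generated|move=> i].
  by exists (orbit_basis i) => //; exact: orbit_basis_neq0.
exists orbit_basis => n; split=> //; first exact: orbit_basis_neq0.
  exact: orbit_letter.
exact: orbit_letter.
Qed.

End OrbitModule.

(** * Determination of the point variety *)

Lemma orbit_seq_id (k : fieldType) (q : P1cube k) n :
  orbit_seq id q n = coord3 q (n %% 3)%N.
Proof. by rewrite /orbit_seq iter_fix. Qed.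

Theorem theorem5p2 (k : closedFieldType)
    (char_k2 : 2%N \notin [pchar k]%R) (char_k3 : 3%N \notin [pchar k]%R) :
  given_by_pair (point_variety k) (@id (P1cube k)).
Proof.
split=> [[[p0 p1] p2] [[q0 q1] q2] pq|].
  (* The first three entries of the sequence recover the triple. *)
  by congr (_, _, _); [have := congr1 (@^~ 0%N) pq | have := congr1 (@^~ 1%N) pq
    | have := congr1 (@^~ 2%N) pq].
apply/seteqP; split=> [P [v vP [M [grM [_ M_of]]]]|_ [q _ <-]].
  have P_period := is_M_of_periodic vP M_of.
  exists (P 0%N, P 1%N, P 2%N) => //; apply: funext => n.
  rewrite orbit_seq_id [in RHS](divn_eq n 3).
  elim: (n %/ 3)%N => [|d ->]; last by rewrite mulSn -addnA P_period.
  by case: (n %% 3)%N (ltn_pmod n (isT : 0 < 3)%N) => [|[|[|]]].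
(* The spanning vector is chosen as a function of the point alone, so that periodicity holds for the
   vectors [v n] themselves and not only for their lines. *)
have [w wE] := choice (@P1_vlineP k).
pose v n := w (orbit_seq id q n).
have vP : represents v (orbit_seq id q) by move=> n; exact: wE.
exists v => //; apply: orbit_is_point_module => n.
  by rewrite /v !orbit_seq_id -addn3 modnDr.
exact: represents_neq0 vP.
Qed.
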